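(* Let $k\ge 1$. The probability mass function of $V(k)$ is given by $$P(V(k)=v)=h_{v-k+1}\,p^k,\qquad v=k,k+1,k+2,\dots,$$ where $h_i=0$ for $i\le 0$, $h_1=1$, and $$h_v=q\left(h_{v-1}+p\,h_{v-2}+p^2h_{v-3}+\cdots+p^{k-1}h_{v-k}\right)\qquad\text{for all } v\ge 2$$ (so that, when $k\ge 2$, $h_2=q$ and $h_3=q^2+pq$).
   Context: $(X_i)_{i\ge1}$ is an infinite sequence of independent Bernoulli trials with $P(X_i=1)=p$, $0<p<1$, and $P(X_i=0)=q=1-p$. For a positive integer $k$, $V(k)$ denotes the waiting time (number of trials) until $k$ consecutive ones first occur, i.e. $V(k)=\min\{n\ge k: X_{n-k+1}=\cdots=X_n=1\}$. *)

(* Defs.v *)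
From mathcomp Require Import all_boot all_order all_algebra.
From mathcomp Require Import all_classical all_reals all_analysis.

Set Implicit Arguments.
Unset Strict Implicit.
Unset Printing Implicit Defensive.

Import Order.TTheory GRing.Theory Num.Theory.

Local Open Scope classical_set_scope.
Local Open Scope ring_scope.

(* Mutual independence of the subfamily (X i) with i in I0: the product rule
   for every finite set of indices s taken from I0. *)
Definition independent_RVs (R : realType) (d d' : measure_display)
    (T : measurableType d) (T' : measurableType d') (P : probability T R)
    (I : choiceType) (I0 : set I) (X : I -> {RV P >-> T'}) : Prop :=
  forall (s : seq I) (A : I -> set T'),
    uniq s -> (forall i, i \in s -> I0 i) ->
    (forall i, i \in s -> measurable (A i)) ->
    P (\bigcap_(i in [set` s]) (X i @^-1` A i)) =
    (\prod_(i <- s) P (X i @^-1` A i))%E.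

(* Trials are numbered from 1; the value X 0 is never used. *)
Definition bernoulli_trials (R : realType) (d : measure_display)
    (T : measurableType d) (P : probability T R) (p : R)
    (X : nat -> {RV P >-> R}) : Prop :=
  [/\ independent_RVs [set i | (1 <= i)%N] X,
      forall i, (1 <= i)%N -> P (X i @^-1` [set 1]) = p%:E &
      forall i, (1 <= i)%N -> P (X i @^-1` [set 0]) = (1 - p)%:E].

(* n >= k and x_(n-k+1) = ... = x_n = 1 *)
Definition run_at (R : realType) (x : nat -> R) (k n : nat) : bool :=
  (k <= n)%N && all (fun i => x i == 1) (index_iota (n - k + 1) n.+1).

(* None stands for an infinite waiting time: no run of k ones ever occurs. *)
Definition waiting_time (R : realType) (x : nat -> R) (k : nat) : option nat :=
  if pselect (exists n, run_at x k n) is left e then Some (ex_minn e) else None.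

(* Main.v *)
Require Import Defs.
From mathcomp Require Import all_boot all_order all_algebra.
From mathcomp Require Import all_classical all_reals all_analysis.
From mathcomp Require Import zify ring.

Set Implicit Arguments.
Unset Strict Implicit.
Unset Printing Implicit Defensive.

Import Order.TTheory GRing.Theory Num.Theory.

Local Open Scope classical_set_scope.
Local Open Scope ring_scope.

(* Reading the trials from the left, only the number [r] of further successes
   needed to complete a run of length [k] matters: a success lowers [r] by one
   and a failure resets it to [k].  If [G r n] is the probability that exactly
   [n] further trials are needed, then [G r.+1 n.+1 = p G r n + q G k n];
   unrolling this until the first failure gives for [G k] the recurrence that
   defines [h], up to the shift by [k - 1] and the factor [p ^+ k]. *)

(** * Words of independent letters and the recurrence for [h] *)

Section BernoulliWords.
Variables (R : realType) (p q : R).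

(** For [q = 1 - p] this is the probability of [Q] for [n] independent letters, obtained by
    conditioning on the first one. *)
Fixpoint word_prob (n : nat) (Q : pred (seq bool)) : R :=
  if n is n'.+1 then
    p * word_prob n' (Q \o cons true) + q * word_prob n' (Q \o cons false)
  else (Q [::])%:R.

Lemma eq_word_prob n (Q Q' : pred (seq bool)) :
  Q =1 Q' -> word_prob n Q = word_prob n Q'.
Proof.
elim: n Q Q' => [|n IHn] Q Q' eQ /=; first by rewrite eQ.
by congr (_ * _ + _ * _); apply: IHn => s /=; rewrite eQ.
Qed.

Lemma word_prob0 n : word_prob n xpred0 = 0.
Proof.
elim: n => //= n IHn.
by rewrite !(@eq_word_prob _ _ xpred0) // IHn !mulr0 addr0.
Qed.

(** Here [r] counts the ones still missing. Letters left over once [r] is 0 cause rejection, so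
    acceptance means a first completion exactly at the last letter. *)
Fixpoint completes (k r : nat) (s : seq bool) : bool :=
  match s, r with
  | [::], _ => r == 0
  | _, 0 => false
  | b :: s', r'.+1 => completes k (if b then r' else k) s'
  end.

Lemma word_prob_completes0 k n :
  word_prob n (completes k 0) = (n == 0)%:R.
Proof.
case: n => [|n] //=; rewrite !(@eq_word_prob _ _ xpred0) //.
by rewrite word_prob0 !mulr0 addr0.
Qed.

(** Words are sorted by the number [j < r] of ones before the first failure, which resets the count
    to [k]; the last term is the word of [r] ones. *)
Lemma word_prob_completes k r n :
  word_prob n (completes k r) =
  q * (\sum_(j < r | (j < n)%N) p ^+ j * word_prob (n - j.+1) (completes k k))
  + (n == r)%:R * p ^+ r.
Proof.
elim: r n => [|r IHr] n.
  by rewrite word_prob_completes0 big_ord0 mulr0 add0r mulr1.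
case: n => [|n]; first by rewrite big1 // mulr0 add0r mul0r.
rewrite /= (@eq_word_prob _ _ (completes k r)) // IHr.
rewrite (@eq_word_prob _ _ (completes k k)) //.
(* The term [j = 0], an immediate failure, is split off; the guard goes inside the sum to allow
   this. *)
rewrite [in RHS]big_mkcond big_ord_recl /= expr0 mul1r subn1 /=.
rewrite -[in RHS]big_mkcond /=.
under [in RHS]eq_bigr => j _ do rewrite exprS -mulrA subSS.
rewrite -mulr_sumr eqSS exprS.
by ring.
Qed.

(** By strong induction on [n], the sum over first failures turns into the recurrence for [h] at
    [n - k + 1]. *)
Lemma word_prob_first_run (k : nat) (h : int -> R) :
  (forall i : int, i <= 0 -> h i = 0) -> h 1 = 1 ->
  (forall v : int, 2 <= v ->
     h v = q * \sum_(j < k) p ^+ j * h (v - 1 - (j : nat)%:Z)) ->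
  forall n, word_prob n (completes k k) = h (n%:Z - k%:Z + 1) * p ^+ k.
Proof.
move=> h_nonpos h_one h_rec; elim/ltn_ind => n IHn.
rewrite word_prob_completes.
have -> : \sum_(j < k | (j < n)%N)
      p ^+ j * word_prob (n - j.+1) (completes k k) =
    (\sum_(j < k) p ^+ j * h (n%:Z - k%:Z - (j : nat)%:Z)) * p ^+ k.
  rewrite mulr_suml big_mkcond; apply: eq_bigr => j _.
  (* Dropping the guard adds only zeros: [n <= j] makes [n - k - j] nonpositive. *)
  case: ltnP => [jn|nj]; last by rewrite h_nonpos ?mulr0 ?mul0r //; lia.
  by rewrite IHn ?mulrA; [congr (_ * h _ * _)|]; lia.
(* The recurrence applies to arguments at least 2, that is to [k < n]; at [n = k] only the word of
   [k] ones counts. *)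
case: (ltngtP n k) => [nk|kn|->].
- rewrite mul0r addr0 h_nonpos ?mul0r; last by lia.
  by rewrite big1 ?mul0r ?mulr0 // => j _; rewrite h_nonpos ?mulr0 //; lia.
- rewrite mul0r addr0 h_rec; last by lia.
  rewrite mulrA; congr (q * _ * _); apply: eq_bigr => j _.
  by congr (_ * h _); lia.
- rewrite subrr add0r h_one mul1r big1 ?mul0r ?mulr0 ?add0r // => j _.
  by rewrite h_nonpos ?mulr0 //; lia.
Qed.

End BernoulliWords.

(** * Runs and waiting time along a fixed sequence *)

Section Runs.
Variables (R : realType) (x : nat -> R).

(** The run of ones that ends at trial [n]; the base value 0 keeps [x 0] out of it. *)
Fixpoint run_length (n : nat) : nat :=
  if n is n'.+1 then if x n == 1 then (run_length n').+1 else 0 else 0.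

Lemma run_atE k n : run_at x k n = (k <= run_length n)%N.
Proof.
elim: n k => [|n IHn] [|k] //=.
- by rewrite /run_at subn0 addn1 /index_iota subnn.
(* A run of [k.+1] ones ending at [n.+1] is a one preceded by a run of [k] ones ending at [n]. *)
rewrite (_ : run_at x _ _ = (x n.+1 == 1) && run_at x k n); last first.
  rewrite /run_at ltnS subSS; case: (leqP k n) => //= kn; last by rewrite andbF.
  rewrite (_ : index_iota _ _ = rcons (index_iota (n - k + 1) n.+1) n.+1).
    by rewrite all_rcons.
  rewrite /index_iota (_ : n.+2 - _ = (n.+1 - (n - k + 1)) + 1)%N; last by lia.
  by rewrite iotaD cats1; congr rcons; lia.
by rewrite IHn; case: ifP.
Qed.

(** After [m] trials [k - run_length m] ones are missing, and this stays true at each letter read: a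
    one lengthens the run, a failure resets it to 0. *)
Lemma completesE k m n : (run_length m <= k)%N ->
  completes k (k - run_length m) [seq x i == 1 | i <- iota m.+1 n] =
  run_at x k (m + n) && all (fun i => ~~ run_at x k i) (iota m n).
Proof.
elim: n m => [|n IHn] m mk /=.
  by rewrite addn0 andbT run_atE subn_eq0.
rewrite [run_at x k m]run_atE -ltnNge.
(* If the run is already complete at [m], letters remain and both sides are false. *)
case: ltnP => [ltmk|]; last by rewrite -subn_eq0 => /eqP ->; rewrite andbF.
have [r Er] : exists r, (k - run_length m = r.+1)%N.
  by exists (k - run_length m).-1; lia.
rewrite addnS -addSn -IHn /=; last by case: ifP.
rewrite Er; case: ifP => _; last by rewrite subn0.
by congr completes; lia.
Qed.

(** This is the start [m = 0], with all [k] ones missing; minimality of [v] is the absence of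
    earlier runs. *)
Lemma waiting_timeE k v :
  waiting_time x k = Some v <->
  completes k k [seq x i == 1 | i <- iota 1 v].
Proof.
have := @completesE k 0 v (leq0n k); rewrite subn0 add0n => ->.
rewrite /waiting_time; split.
  case: pselect => // e [<-]; case: ex_minnP => m -> min_m /=.
  apply/allP => i; rewrite mem_iota => /andP[_ im].
  by apply/negP => /min_m; rewrite leqNgt im.
move=> /andP[rv /allP nrv]; case: pselect => [e|]; last by case; exists v.
congr Some; case: ex_minnP => m rm min_m; apply/eqP.
rewrite eqn_leq min_m // leqNgt; apply/negP => mv.
by have := nrv m; rewrite mem_iota rm => /(_ mv).
Qed.

End Runs.

(** * From finite words to the probability space *)

Section Trials.
Context (R : realType) (d : measure_display) (T : measurableType d).
Variables (P : probability T R) (p : R) (X : nat -> {RV P >-> R}).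
Hypothesis hX : bernoulli_trials p X.

Let outcome (w : T) (i : nat) : bool := X i w == 1.
(** Failure is the complement of 1, not [[set 0]]: the two outcomes then cover every sample point,
    even where [X i] takes another value. *)
Let value_set (b : bool) : set R := if b then [set 1] else ~` [set 1].

Let measurable_value_set b : measurable (value_set b).
Proof. by case: b; [|apply: measurableC]; exact: measurable_set1. Qed.

Let measurable_outcome i b : measurable (X i @^-1` value_set b).
Proof. by rewrite -[_ @^-1` _]setTI; exact: measurable_funP. Qed.

Lemma outcomeE i b w : (X i @^-1` value_set b) w <-> outcome w i = b.
Proof.
rewrite /preimage /outcome /value_set; case: b => /=.
  by split=> [->|/eqP] //; rewrite eqxx.
by split=> [/eqP/negbTE|/eqP].
Qed.

Lemma prob_outcome i b : (1 <= i)%N ->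
  P (X i @^-1` value_set b) = (if b then p else 1 - p)%:E.
Proof.
case: hX => _ hp _ i1; case: b; first exact: hp.
by rewrite /value_set -preimage_setC probability_setC ?hp.
Qed.

Lemma prob_prefix (t : seq bool) :
  P [set w | [seq outcome w i | i <- iota 1 (size t)] = t] =
  (\prod_(b <- t) (if b then p else 1 - p))%:E.
Proof.
case: hX => indep _ _.
(* Trials start at 1 and letters at 0, so trial [i] carries the letter [i.-1]. *)
rewrite (_ : [set w | _] = \bigcap_(i in [set` iota 1 (size t)])
    (X i @^-1` value_set (nth false t i.-1))); last first.
  apply/seteqP; split => w /=.
    move=> tE i /=; rewrite mem_iota => /andP[i1 it]; apply/outcomeE.
    rewrite -[in RHS]tE (nth_map 0%N) ?size_iota ?nth_iota; try lia.
    by congr outcome; lia.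
  move=> tE; apply: (@eq_from_nth _ false); first by rewrite size_map size_iota.
  rewrite size_map size_iota => i it.
  rewrite (nth_map 0%N) ?size_iota // nth_iota //.
  by apply/outcomeE/(tE (1 + i)%N) => /=; rewrite mem_iota; lia.
rewrite indep ?iota_uniq //; last by move=> i; rewrite /= mem_iota => /andP[].
rewrite [in LHS]big_seq.
under eq_bigr => i.
  rewrite mem_iota => /andP[i1 _]; rewrite prob_outcome //; over.
rewrite -big_seq prodEFin; congr EFin.
rewrite (iotaDl 1 0) big_map (big_nth false) /index_iota subn0.
exact: eq_bigr.
Qed.

Lemma measurable_word m n (Q : pred (seq bool)) :
  measurable [set w | Q [seq outcome w i | i <- iota m n]].
Proof.
elim: n m Q => [|n IHn] m Q /=.
  case: (Q [::]);
    [rewrite (_ : [set _ | _] = setT)|rewrite (_ : [set _ | _] = set0)] => //.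
  - by apply/seteqP; split.
  - by apply/seteqP; split.
rewrite (_ : [set w | _] =
    (X m @^-1` value_set true) `&`
      [set w | (Q \o cons true) [seq outcome w i | i <- iota m.+1 n]] `|`
    (X m @^-1` value_set false) `&`
      [set w | (Q \o cons false) [seq outcome w i | i <- iota m.+1 n]]).
  by apply: measurableU; apply: measurableI => //; exact: IHn.
apply/seteqP; split => w.
  move=> Qw; rewrite /= in Qw; case E: (outcome w m) Qw => Qw; [left|right];
  by split; [exact/outcomeE|exact: Qw].
by move=> [] [/outcomeE + Qw]; rewrite /mkset /= => ->.
Qed.

(** The prefix [t] makes induction on [n] possible: the next outcome is appended to it, and
    independence enters only at [n = 0], through [prob_prefix]. *)
Lemma prob_prefix_word n (t : seq bool) (Q : pred (seq bool)) :
  P [set w | [seq outcome w i | i <- iota 1 (size t)] = t /\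
             Q [seq outcome w i | i <- iota (size t).+1 n]] =
  (\prod_(b <- t) (if b then p else 1 - p) * word_prob p (1 - p) n Q)%:E.
Proof.
elim: n t Q => [|n IHn] t Q /=.
  case: (Q [::]); rewrite ?mulr1 ?mulr0.
    by rewrite -prob_prefix; congr (P _); apply/seteqP; split => w //= [].
  by rewrite -[RHS](measure0 P); congr (P _); apply/seteqP; split => w //= [].
pose E b := [set w |
    [seq outcome w i | i <- iota 1 (size (rcons t b))] = rcons t b /\
    (Q \o cons b) [seq outcome w i | i <- iota (size (rcons t b)).+1 n]].
have rconsE w b :
    [seq outcome w i | i <- iota 1 (size (rcons t b))] = rcons t b <->
    [seq outcome w i | i <- iota 1 (size t)] = t /\ outcome w (size t).+1 = b.
  rewrite size_rcons -(addn1 (size t)) iotaD map_cat cats1 add1n addn1; split.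
    by move/rcons_inj => [].
  by move=> [-> ->].
have mE b : measurable (E b).
  apply: measurableI; last exact: measurable_word.
  have := @measurable_word 1 (size (rcons t b)) (pred1 (rcons t b)).
  by congr measurable; apply/seteqP; split => w /= /eqP.
rewrite (_ : [set w | _] = E true `|` E false).
  rewrite measureU //; last first.
    apply/seteqP; split => // w [[/rconsE[_ E1] _] [/rconsE[_ E2] _]].
    by move: E1; rewrite E2.
  have PE b : P (E b) = (\prod_(b <- t) (if b then p else 1 - p) *
      (if b then p else 1 - p) * word_prob p (1 - p) n (Q \o cons b))%:E.
    by rewrite (IHn (rcons t b)) -cats1 big_cat big_seq1.
  rewrite [LHS](_ : _ = P (E true) + P (E false))%E // !PE -EFinD /=.
  by congr EFin; ring.
apply/seteqP; split => w; rewrite /E /=.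
  move=> [tE Qw]; case Eo: (outcome w (size t).+1) in Qw; [left|right];
  by split; [exact/rconsE|rewrite size_rcons].
by move=> [] [/rconsE[-> ->]]; rewrite size_rcons.
Qed.

Lemma prob_word n (Q : pred (seq bool)) :
  P [set w | Q [seq X i w == 1 | i <- iota 1 n]] =
  (word_prob p (1 - p) n Q)%:E.
Proof.
have := prob_prefix_word n [::] Q; rewrite big_nil mul1r => <-.
by congr (P _); apply/seteqP; split => w //= [].
Qed.

End Trials.

Theorem theorem2p3 (R : realType) (d : measure_display) (T : measurableType d)
  (P : probability T R) (p q : R) (X : nat -> {RV P >-> R}) (k : nat)
  (h : int -> R)
  (hp0 : 0 < p) (hp1 : p < 1) (hq : q = 1 - p)
  (hX : bernoulli_trials p X)
  (hk : (1 <= k)%N)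
  (h_nonpos : forall i : int, i <= 0 -> h i = 0)
  (h_one : h 1 = 1)
  (h_rec : forall v : int, 2 <= v ->
     h v = q * \sum_(j < k) p ^+ j * h (v - 1 - (j : nat)%:Z)) :
  (forall v : nat, (k <= v)%N ->
     P [set w | waiting_time (fun i => X i w) k = Some v]
     = (h (v%:Z - k%:Z + 1) * p ^+ k)%:E) /\
  ((2 <= k)%N -> h 2 = q /\ h 3 = q ^+ 2 + p * q).
Proof.
split=> [v _|].
  (* Both sides equal [word_prob p (1 - p) v (completes k k)]. *)
  rewrite -(word_prob_first_run h_nonpos h_one h_rec) hq -(prob_word hX).
  by congr (P _); apply/seteqP; split => w /waiting_timeE.
case: k h_rec {hk} => [|[|k]] // h_rec _.
have h2 : h 2 = q.
  (* Only [j = 0] contributes, since [1 - j] is nonpositive for the other indices. *)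
  rewrite h_rec // big_ord_recl big1 ?expr0 ?mul1r ?addr0 /=.
    by rewrite [h _]h_one mulr1.
  by move=> j _; rewrite h_nonpos ?mulr0 // /bump /=; lia.
split=> //.
(* Now [j = 0] and [j = 1] contribute, through [h 2] and [h 1]. *)
rewrite h_rec // 2!big_ord_recl big1 ?addr0 /=.
  rewrite [LHS](_ : _ = q * (p ^+ 0 * h 2 + p ^+ 1 * h 1)) // h2 h_one.
  by ring.
by move=> j _; rewrite h_nonpos ?mulr0 // /bump /=; lia.
Qed.
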